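(* Let $p$ be a prime and let $G$ be a generalised $p$-central finite $p$-group. Then $G$ is strongly semi-$p$-abelian; that is, for every $i\ge 1$ and all $x,y\in G$, we have $x^{p^i}=y^{p^i}$ if and only if $(xy^{-1})^{p^i}=1$.
   Context: For a finite $p$-group $G$, $\Omega_i(G)$ is the subgroup generated by all elements of $G$ of order at most $p^i$, and $Z_j(G)$ is the $j$th term of the upper central series ($Z_1(G)=Z(G)$). A finite $p$-group $G$ is generalised $p$-central if $\Omega_1(G)\le Z_{p-2}(G)$ when $p$ is odd, and if $\Omega_2(G)\le Z(G)$ when $p=2$. *)

(* Defs.v *)
From mathcomp Require Import all_boot all_fingroup all_solvable.

Set Implicit Arguments.
Unset Strict Implicit.
Unset Printing Implicit Defensive.

Local Open Scope group_scope.

(* 'Ohm_i(G) is generated by the x in G with x ^+ (pdiv #[x] ^ i) = 1; in a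
   p-group these are exactly the elements of order at most p ^ i (see OhmE). *)
Definition generalised_p_central (gT : finGroupType) (p : nat)
    (G : {group gT}) : Prop :=
  if p == 2%N then 'Ohm_2(G) \subset 'Z(G)
  else 'Ohm_1(G) \subset 'Z_(p - 2)(G).

Definition strongly_semi_p_abelian (gT : finGroupType) (p : nat)
    (G : {group gT}) : Prop :=
  forall i : nat, 1 <= i ->
  forall x y : gT, x \in G -> y \in G ->
    x ^+ (p ^ i) = y ^+ (p ^ i) <-> (x * y^-1) ^+ (p ^ i) = 1.

(* Main.v *)
Require Import Defs.
From mathcomp Require Import all_boot all_fingroup all_solvable.

(** The statement reduces to the exponent p itself, provided that the class of
groups under study is stable under G |-> G / 'Ohm_1(G): if x ^+ p = y ^+ p is
equivalent to (x * y^-1) ^+ p = 1, then the elements killed by p form the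
group 'Ohm_1(G), so the case of p ^ i.+1 in G is the case of p ^ i in
G / 'Ohm_1(G) followed by the case of p in G (strongly_semi_p_abelian_ind).

For p = 2 both requirements are direct: if x and y have the same square, then
x inverts u = x * y^-1, and a power of u of order 4 would be central and
inverted by x.

For odd p the tool is Hall's theorem on groups in which the term 'L_p of the
lower central series is trivial: if moreover the derived subgroup has exponent
p, then x |-> x ^+ p is a morphism (expMg_lcn_prime).  It comes from the
sequence f n = (x^n y^n)^-1 (xy)^n.  Sequences whose k-th multiplicative
differences take values in 'L_k are closed under products (Lazard, Leibman),
so f is a product of sequences n |-> a_j ^+ 'C(n, j) with a_j in 'L_j; as
a_0 = a_1 = 1, as p divides 'C(p, j) for 0 < j < p, and as a_p is in 'L_p,
f p = 1.

Let G be p-central, that is, let all u with u ^+ p = 1 lie in 'Z_(p-2)(G), and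
let x ^+ p = y ^+ p.  Then x and its conjugate x ^ y have the same p-th power
and lie in a proper subgroup of G unless G is cyclic, so [x, y] = x^-1 x^y is killed by p by
induction on #|G|.  Hence [x, y] is in 'Z_(p-2)(G), the group generated by x
and y has trivial 'L_p, and its derived subgroup has exponent p, by induction
again.  Hall's theorem gives (x * y^-1) ^+ p = 1 (p_central_divgX).

It remains to show that G / 'Ohm_1(G) is p-central.  By induction on j <= p-2,
if x ^+ p is in 'Z_j(G) then x is in the j-th centre of G modulo the elements
killed by p (expg_ucn_comm_descent).  Indeed the assertion for j says that
G / 'Z_j(G) is again p-central; if x ^+ p is in 'Z_(j+1)(G), then x and x ^ g
have the same p-th power modulo 'Z_j(G), so the previous result in this
quotient gives [x, g] ^+ p in 'Z_j(G).  Finally, if the image of x in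
G / 'Ohm_1(G) is killed by p, then x ^+ p is in 'Ohm_1(G), which is contained
in 'Z_(p-2)(G). *)

Set Implicit Arguments.
Unset Strict Implicit.
Unset Printing Implicit Defensive.

Local Open Scope group_scope.

(** * Differences of sequences and the lower central series *)

Lemma three_subgroup_mod (gT : finGroupType) (N G H K : {group gT}) :
    G \subset 'N(N) -> H \subset 'N(N) -> K \subset 'N(N) ->
    [~: G, H, K] \subset N -> [~: H, K, G] \subset N -> [~: K, G, H] \subset N.
Proof.
have qR (A B C : {group gT}) : A \subset 'N(N) -> B \subset 'N(N) -> C \subset 'N(N) ->
    ([~: A, B, C] \subset N) = ([~: A / N, B / N, C / N] == 1).
  move=> nA nB nC; have nAB : [~: A, B] \subset 'N(N) by rewrite comm_subG.
  by rewrite -!quotientR // -subG1 quotient_sub1 // comm_subG.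
move=> nG nH nK; rewrite !qR // => /eqP GHK /eqP HKG.
by apply/eqP; exact: three_subgroup.
Qed.

Lemma commg_lcn (gT : finGroupType) (G : {group gT}) i j :
  [~: 'L_i(G), 'L_j(G)] \subset 'L_(i + j)(G).
Proof.
elim: j i => [|j IHj] i.
  rewrite addn0 commg_subl; exact: (normal_norm (lcn_normal _ _)).
case: j IHj => [_|j IHj].
  by rewrite addn1 lcn1; exact: lcnSnS.
have nL k m : 'L_m(G) \subset 'N('L_k(G)).
  by rewrite (subset_trans (lcn_sub m G)) ?lcn_norm.
rewrite (lcnSn j) commGC; apply: three_subgroup_mod; rewrite ?lcn_norm ?nL //.
  rewrite (commGC G) addnS -addSn; apply: subset_trans (IHj i.+1).
  exact/commSg/lcnSnS.
rewrite addnS; apply: subset_trans (lcnSnS _ _).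
exact/commSg/IHj.
Qed.

Definition gdiff (gT : finGroupType) (f : nat -> gT) (i : nat) : gT :=
  (f i)^-1 * f i.+1.

(** The sequences that are polynomial up to depth n: for m <= n their m-th
differences take values in 'L_(k + m)(G).  As 'L_0(G) = 'L_1(G) = G, the
powers of an element of G form such a sequence for k = 0.  The bound n makes
the closure properties provable by induction. *)
Fixpoint poly_seq (gT : finGroupType) (G : {set gT}) (n k : nat)
    (f : nat -> gT) : Prop :=
  (forall i, f i \in 'L_k(G)) /\
  (if n is n'.+1 then poly_seq G n' k.+1 (gdiff f) else True).

Lemma eq_poly_seq (gT : finGroupType) (G : {set gT}) n k (f g : nat -> gT) :
  f =1 g -> poly_seq G n k f -> poly_seq G n k g.
Proof.
elim: n k f g => [|n IHn] k f g fg [Lf Df]; split=> [i|] //; rewrite -?fg //.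
by apply: IHn Df => i; rewrite /gdiff !fg.
Qed.

Lemma poly_seq_le (gT : finGroupType) (G : {group gT}) m n k l (f : nat -> gT) :
  m <= n -> k <= l -> poly_seq G n l f -> poly_seq G m k f.
Proof.
elim: m n k l f => [|m IHm] [|n] k l f //= le_mn le_kl [Lf Df].
- by split=> // i; exact: (subsetP (lcn_sub_leq _ le_kl)).
- by split=> // i; exact: (subsetP (lcn_sub_leq _ le_kl)).
by split; [move=> i; exact: (subsetP (lcn_sub_leq _ le_kl)) | exact: IHm Df].
Qed.

Lemma poly_seqS (gT : finGroupType) (G : {group gT}) n k (f : nat -> gT) :
  poly_seq G n.+1 k f -> poly_seq G n k f.
Proof. exact: poly_seq_le. Qed.

(** The theorem of Lazard and Leibman.  The difference of a product is
(gdiff f) ^ g * gdiff g, and that of a commutator splits into commutators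
with one factor differenced, so that each closure property at depth n.+1
needs several of them at depth n; hence they are proved together. *)
Lemma poly_seq_closed (gT : finGroupType) (G : {group gT}) n :
  [/\ forall k f g, poly_seq G n k f -> poly_seq G n k g ->
        poly_seq G n k (fun i => f i * g i),
      forall k f, poly_seq G n k f -> poly_seq G n k (fun i => (f i)^-1)
    & forall k l f g, poly_seq G n k f -> poly_seq G n l g ->
        poly_seq G n (k + l) (fun i => [~ f i, g i])].
Proof.
have Lcomm k l x y : x \in 'L_k(G) -> y \in 'L_l(G) -> [~ x, y] \in 'L_(k + l)(G).
  by move=> Lx Ly; apply: (subsetP (commg_lcn G k l)); exact: mem_commg.
elim: n => [|n [IHM IHV IHR]].
  split=> [k f g [Lf _] [Lg _] | k f [Lf _] | k l f g [Lf _] [Lg _]]; split=> // i.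
  - exact: groupM.
  - exact: groupVr.
  - exact: Lcomm.
split=> [k f g Pf Pg | k f Pf | k l f g Pf Pg].
- have [Lf Df] := Pf; have [Lg Dg] := Pg.
  split=> [i|]; first exact: groupM.
  have Pr : poly_seq G n k.+1 (fun i => [~ gdiff f i, g i]).
    apply: poly_seq_le (leqnn _) _ (IHR _ _ _ _ Df (poly_seqS Pg)).
    by rewrite leq_addr.
  apply: eq_poly_seq (IHM _ _ _ (IHM _ _ _ Df Pr) Dg) => i.
  by rewrite -conjg_mulR conjgE /gdiff invMg !mulgA mulgK.
- have [Lf Df] := Pf; split=> [i|]; first exact: groupVr.
  have PV := IHV _ _ Df; have PfV := IHV _ _ (poly_seqS Pf).
  have Pr := IHR _ _ _ _ PV PfV.
  apply: eq_poly_seq (IHM _ _ _ PV (poly_seq_le (leqnn _) _ Pr)) => [i|].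
    by rewrite -conjg_mulR conjgE /gdiff invMg !invgK mulgK.
  by rewrite leq_addr.
have [Lf Df] := Pf; have [Lg Dg] := Pg.
split=> [i|]; first exact: Lcomm.
have {Lf} Pf' := poly_seqS Pf; have {Lg} Pg' := poly_seqS Pg.
(* With f' = f d and g' = g e the shifted sequences,
   [f', g'] = [f d, e] * ([f, g] ^ d * [d, g]) ^ e. *)
pose c i := [~ f i, g i]; pose u i := [~ f i * gdiff f i, gdiff g i].
pose v i := [~ gdiff f i, g i]; pose de i := gdiff f i * gdiff g i.
have Pc : poly_seq G n (k + l) c by exact: IHR.
have Pu : poly_seq G n (k + l).+1 u.
  rewrite -addnS; apply: IHR => //; apply: IHM => //.
  exact: poly_seq_le Df.
have Pv : poly_seq G n (k + l).+1 v by rewrite -addSn; exact: IHR.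
have Pde : poly_seq G n 1 de by apply: IHM;
  [exact: poly_seq_le Df | exact: poly_seq_le Dg].
have PJ h t : poly_seq G n (k + l).+1 h -> forall m, poly_seq G n m t ->
    poly_seq G n (k + l).+1 (fun i => h i * [~ h i, t i]).
  move=> Ph m Pt; apply: IHM => //.
  by apply: poly_seq_le (leqnn _) _ (IHR _ _ _ _ Ph Pt); rewrite leq_addr.
have Pcde : poly_seq G n (k + l).+1 (fun i => [~ c i, de i]).
  by rewrite -addn1; exact: IHR.
have Puc := PJ _ _ Pu _ Pc; have Pve := PJ _ _ Pv _ Dg.
apply: eq_poly_seq (IHM _ _ _ (IHM _ _ _ Puc Pcde) Pve) => i.
have eqS h j : h j.+1 = h j * gdiff h j :> gT by rewrite /gdiff mulKVg.
have -> : gdiff (fun i => [~ f i, g i]) i =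
          (c i)^-1 * [~ f i * gdiff f i, g i * gdiff g i].
  by rewrite -!eqS.
rewrite commgMJ -/(u i) commMgJ -/(c i) -/(v i) conjMg -conjgM -/(de i).
rewrite -(conjg_mulR (u i)) -(conjg_mulR (v i)) (conjgE (u i)) (conjg_mulR (c i)).
by rewrite -!mulgA.
Qed.

Lemma poly_seq_binX (gT : finGroupType) (G : {group gT}) n k j (a : gT) :
  a \in 'L_(k + j)(G) -> poly_seq G n k (fun i => a ^+ 'C(i, j)).
Proof.
elim: n k j a => [|n IHn] k j a La; split=> [i|] //;
  rewrite ?groupX // ?(subsetP (lcn_sub_leq _ (leq_addr j k))) //.
case: j La => [|j] La.
  apply: eq_poly_seq (IHn k.+1 0 1 (group1 _)) => i.
  by rewrite /gdiff !bin0 mulVg expg1n.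
rewrite addnS -addSn in La.
apply: eq_poly_seq (IHn _ _ _ La) => i.
by rewrite /gdiff binS expgD mulKg.
Qed.

(** While f takes the value 1 its differences just shift it, so its first
nontrivial value is an iterated difference. *)
Lemma poly_seq_first (gT : finGroupType) (G : {group gT}) n k j (f : nat -> gT) :
  j <= n -> poly_seq G n k f -> (forall i, i < j -> f i = 1) -> f j \in 'L_(k + j)(G).
Proof.
elim: j n k f => [|j IHj] n k f; first by rewrite addn0; case: n => [|n] _ [].
case: n => // n le_jn [_ Df] f1.
have -> : f j.+1 = gdiff f j by rewrite /gdiff (f1 j) ?invg1 ?mul1g.
rewrite addnS -addSn; apply: IHj Df _ => // i lt_ij.
by rewrite /gdiff !f1 ?invg1 ?mul1g // ltnW.
Qed.

(** Dividing f by n |-> a ^+ 'C(n, j), where a = f j is its first nontrivial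
value, moves this value further; as a is in 'L_j(G), it is killed by p when
1 < j, and f p, which is divided by a ^+ 'C(p, j) = 1, does not change while
j < p. *)
Lemma poly_seq_prime (gT : finGroupType) (G : {group gT}) p n (f : nat -> gT) :
    prime p -> 'L_p(G) = 1 -> {in G^`(1), forall u, u ^+ p = 1} ->
    p <= n -> poly_seq G n 0 f -> f 0%N = 1 -> f 1%N = 1 ->
  f p = 1.
Proof.
move=> pr_p Lp1 expG le_pn Pf f0 f1.
have main d : d.+2 <= p -> forall h, poly_seq G n 0 h ->
    (forall i, i < p - d -> h i = 1) -> h p = 1.
  elim: d => [|d IHd] lt_dp h Ph h1.
    rewrite subn0 in h1; apply/set1gP; rewrite -Lp1.
    exact: poly_seq_first Ph h1.
  set j := p - d.+1 in h1; have lt_jp : j < p by rewrite /j ltn_subrL (prime_gt0 pr_p).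
  have j_gt1 : 1 < j by rewrite /j ltn_subRL addn1.
  have La := poly_seq_first (leq_trans (ltnW lt_jp) le_pn) Ph h1.
  have aG' : h j \in G^`(1) by apply: (subsetP (lcn_sub_leq G j_gt1)).
  have ap : (h j) ^+ 'C(p, j) = 1.
    have /dvdnP[q ->] : p %| 'C(p, j) by rewrite prime_dvd_bin // lt_jp ltnW.
    by rewrite mulnC expgM expG // expg1n.
  have [PM PV _] := poly_seq_closed G n.
  have Pa := PV _ _ (poly_seq_binX n (k := 0) La).
  have := IHd (ltnW lt_dp) _ (PM _ _ _ Pa Ph) _.
  rewrite ap invg1 mul1g; apply=> i.
  have -> : p - d = j.+1 by rewrite /j subnSK // ltnW // ltnW.
  rewrite ltnS leq_eqVlt => /predU1P[-> | lt_ij]; first by rewrite binn mulVg.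
  by rewrite bin_small // (h1 i) // expg0 invg1 mulg1.
apply: (main p.-2) Pf _ => [|i]; first by rewrite -subn2 -addn2 subnK ?prime_gt1.
by rewrite -subn2 subKn ?prime_gt1 //; case: i => [|[]].
Qed.

(** Hall's theorem, in the case where no p-th powers of commutators remain. *)
Lemma expMg_lcn_prime (gT : finGroupType) (G : {group gT}) p (x y : gT) :
    prime p -> 'L_p(G) = 1 -> {in G^`(1), forall u, u ^+ p = 1} ->
    x \in G -> y \in G ->
  (x * y) ^+ p = x ^+ p * y ^+ p.
Proof.
move=> pr_p Lp1 expG Gx Gy.
have [PM PV _] := poly_seq_closed G p.
have PX a : a \in G -> poly_seq G p 0 (fun i => a ^+ i).
  move=> Ga; apply: eq_poly_seq (poly_seq_binX p (k := 0) (j := 1) _) => [i|].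
    by rewrite bin1.
  by rewrite lcn1.
have Pf := PM _ _ _ (PV _ _ (PM _ _ _ (PX _ Gx) (PX _ Gy))) (PX _ (groupM Gx Gy)).
have := poly_seq_prime pr_p Lp1 expG (leqnn p) Pf.
rewrite !expg0 !expg1 mul1g invg1 mul1g mulVg => /(_ erefl erefl) eq1.
by apply/esym/eqP; rewrite eq_mulVg1 eq1.
Qed.

(** * Groups whose elements killed by p lie in 'Z_(p - 2) *)

Lemma ucnSP (gT : finGroupType) (G : {group gT}) n x :
  reflect (x \in G /\ {in G, forall g, [~ x, g] \in 'Z_n(G)}) (x \in 'Z_n.+1(G)).
Proof.
rewrite ucnSnR inE; apply: (iffP andP) => [[Gx /subsetP sZ] | [Gx Zx]]; split=> //.
  by move=> g Gg; apply: sZ; rewrite mem_commg ?set11.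
rewrite gen_subG; apply/subsetP=> _ /imset2P[_ g /set1P-> Gg ->]; exact: Zx.
Qed.

Lemma ucn_setI_sub (gT : finGroupType) (G H : {group gT}) n :
  H \subset G -> 'Z_n(G) :&: H \subset 'Z_n(H).
Proof.
move=> sHG; elim: n => [|n IHn]; first by rewrite !ucn0 subsetIl.
apply/subsetP=> x /setIP[/ucnSP[_ Zx] Hx]; apply/ucnSP; split=> // g Hg.
by rewrite (subsetP IHn) // inE Zx ?(subsetP sHG) // groupR.
Qed.

Lemma lcn_sub_ucn (gT : finGroupType) (G K : {group gT}) n m :
  K \subset G -> K^`(1) \subset 'Z_(n + m)(G) -> 'L_n.+2(K) \subset 'Z_m(G).
Proof.
move=> sKG; elim: n m => [|n IHn] m; first by rewrite lcn2.
rewrite addSnnS => /IHn sLZ; rewrite lcnSn.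
exact: subset_trans (commgSS sLZ sKG) (ucn_comm _ _).
Qed.

Lemma der1_gen2_sub (gT : finGroupType) (N : {group gT}) (x y : gT) :
    x \in 'N(N) -> y \in 'N(N) -> [~ x, y] \in N ->
  <<[set x; y]>>^`(1) \subset N.
Proof.
move=> nNx nNy Nxy.
have nNS : [set x; y] \subset 'N(N) by rewrite subUset !sub1set nNx.
apply: der1_min; first by rewrite gen_subG.
rewrite quotient_gen // abelian_gen /abelian quotient_cents2 // gen_subG.
apply/subsetP=> _ /imset2P[a b /set2P[]-> /set2P[]-> ->] //; rewrite ?commgg ?group1 //.
by rewrite -invg_comm groupV.
Qed.

Lemma group_set_Ldiv (p : nat) (gT : finGroupType) (G : {group gT}) :
    {in G &, forall x y, x ^+ p = y ^+ p -> (x * y^-1) ^+ p = 1} ->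
  group_set 'Ldiv_p(G).
Proof.
move=> divX; apply/group_setP; split=> [|u v /LdivP[Gu up] /LdivP[Gv vp]].
  by apply/LdivP; rewrite group1 expg1n.
apply/LdivP; rewrite groupM //; split=> //.
by rewrite -[v]invgK; apply: divX; rewrite ?groupV // up expgVn vp invg1.
Qed.

Lemma norm_Ldiv (p : nat) (gT : finGroupType) (G H : {group gT}) :
  G \subset 'N(H) -> G \subset 'N('Ldiv_p(H)).
Proof.
move=> nHG; apply/subsetP=> g Gg; rewrite inE.
apply/subsetP=> _ /imsetP[u /LdivP[Hu up] ->]; apply/LdivP.
by rewrite memJ_norm ?(subsetP nHG) // -conjXg up conj1g.
Qed.

(** Requiring 'Ohm_1(G) \subset 'Z_(p - 2)(G) element by element makes the
property easy to transfer to subgroups, and to check in quotients without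
knowing the structure of their 'Ohm_1. *)
Definition p_central (p : nat) (gT : finGroupType) (G : {group gT}) : Prop :=
  {in G, forall u, u ^+ p = 1 -> u \in 'Z_(p - 2)(G)}.

Lemma p_centralS (p : nat) (gT : finGroupType) (G H : {group gT}) :
  H \subset G -> p_central p G -> p_central p H.
Proof.
move=> sHG pcG u Hu up1; apply: (subsetP (ucn_setI_sub _ sHG)).
by rewrite inE Hu pcG // (subsetP sHG).
Qed.

(** Both assumptions on [x, y] pass to the whole derived subgroup of <<x, y>>,
which is the normal closure of [x, y] in it, and the second one kills 'L_p. *)
Lemma expMg_comm_torsion (p : nat) (gT : finGroupType) (G T : {group gT}) (x y : gT) :
    prime p -> G \subset 'N(T) -> {in T, forall u, u ^+ p = 1} ->
    x \in G -> y \in G -> [~ x, y] \in T -> [~ x, y] \in 'Z_(p - 2)(G) ->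
  (x * y) ^+ p = x ^+ p * y ^+ p.
Proof.
move=> pr_p nTG expT Gx Gy Txy Zxy; pose K := <<[set x; y]>>%G.
have sKG : K \subset G by rewrite gen_subG subUset !sub1set Gx.
have sK'Z : K^`(1) \subset 'Z_(p - 2)(G).
  by apply: der1_gen2_sub; rewrite ?(subsetP (ucn_norm _ _)).
have sK'T : K^`(1) \subset T by apply: der1_gen2_sub; rewrite ?(subsetP nTG).
apply: (@expMg_lcn_prime _ K) => //; first 1 last.
- by move=> u /(subsetP sK'T)/expT.
- by rewrite mem_gen ?set21.
- by rewrite mem_gen ?set22.
have := lcn_sub_ucn (n := p - 2) (m := 0) sKG.
by rewrite addn0 -(addn2 (p - 2)) subnK ?prime_gt1 // ucn0 subG1 => /(_ sK'Z)/eqP.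
Qed.

(** Induction on the order of G: the commutator [x, y] = x^-1 * x ^ y is a
quotient of two elements with the same p-th power in <x> 'Phi(G), a proper
subgroup unless G is cyclic, and the elements of G^`(1) killed by p form a
group. *)
Lemma p_central_divgX (p : nat) (gT : finGroupType) (G : {group gT}) :
    prime p -> p.-group G -> p_central p G ->
  {in G &, forall x y, x ^+ p = y ^+ p -> (x * y^-1) ^+ p = 1}.
Proof.
move=> pr_p; have [n] := ubnP #|G|; elim: n gT G => // n IHn gT G leGn pG pcG.
move=> x y Gx Gy eq_xy.
have IH (H : {group gT}) : H \proper G ->
    {in H &, forall a b, a ^+ p = b ^+ p -> (a * b^-1) ^+ p = 1}.
  move=> prH; have sHG := proper_sub prH.
  apply: IHn (pgroupS sHG pG) (p_centralS sHG pcG).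
  exact: leq_trans (proper_card prH) leGn.
have [trG | ntG] := eqVneq (G : {set gT}) 1.
  by move: Gx Gy; rewrite trG => /set1P-> /set1P->; rewrite mul1g invg1 expg1n.
have sG'Phi : G^`(1) \subset 'Phi(G) by rewrite (Phi_joing pG) joing_subl.
have xy_p1 : [~ x, y] ^+ p = 1.
  have [defG | prM] := eqVneq ('Phi(G) <*> [set x]) G.
    have cGG : abelian G by rewrite -(Phi_nongen defG) cycle_abelian.
    by have /commgP/eqP-> := centsP cGG _ Gx _ Gy; rewrite expg1n.
  pose M := ('Phi(G) <*> [set x])%G.
  have prMG : M \proper G.
    by rewrite properEneq prM join_subG Phi_sub sub1set.
  have Mx : x \in M by rewrite mem_gen // inE set11 orbT.
  have MG' u : u \in G^`(1) -> u \in M.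
    by move/(subsetP sG'Phi) => Pu; rewrite mem_gen // inE Pu.
  have Mxy : x ^ y \in M by rewrite conjg_mulR groupM // MG' // mem_commg.
  rewrite commgEl -[x ^ y]invgK; apply: (IH M prMG); rewrite ?groupV //.
  (* x ^+ p = y ^+ p commutes with y. *)
  rewrite !expgVn; congr _^-1; rewrite -conjXg eq_xy.
  by rewrite conjgE -expgSr expgS mulKg.
have prG' : G^`(1) \proper G.
  exact: sol_der1_proper (nilpotent_sol (pgroup_nil pG)) (subxx G) ntG.
have gT1 : group_set 'Ldiv_p(G^`(1)) := group_set_Ldiv (IH _ prG').
have Tuv : [~ x, y^-1] \in Group gT1.
  have cxy: [~ x, y^-1] = ([~ x, y]^-1) ^ y^-1.
    by rewrite invg_comm !commgEl !conjgE !invgK !mulgA mulgV mul1g.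
  apply/LdivP; rewrite mem_commg ?groupV //; split=> //.
  by rewrite cxy -conjXg expgVn xy_p1 invg1 conj1g.
have Z1 : [~ x, y^-1] \in 'Z_(p - 2)(G).
  by case/LdivP: Tuv => G'u; apply: pcG; exact: (subsetP (der1_subG _)).
rewrite (expMg_comm_torsion pr_p (G := G) (T := Group gT1)) ?groupV //.
- by rewrite eq_xy expgVn mulgV.
- exact: norm_Ldiv (der_norm 1 G).
by move=> u /LdivP[].
Qed.

(** For a normal subgroup A this is membership of x in the n-th centre of G
modulo A; it also makes sense for a set A, such as the elements killed by p,
before it is known to be a group. *)
Fixpoint comm_descent (gT : finGroupType) (G A : {set gT}) (n : nat) (x : gT) : Prop :=
  if n is n'.+1 then {in G, forall g, comm_descent G A n' [~ x, g]} else x \in A.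

Lemma comm_descent_trans (gT : finGroupType) (G A B : {set gT}) m n x :
    {in A, forall a, comm_descent G B n a} -> comm_descent G A m x ->
  comm_descent G B (m + n) x.
Proof.
move=> AB; elim: m x => [|m IHm] x; first exact: AB.
by move=> Ax g Gg; apply: IHm; exact: Ax.
Qed.

Lemma ucn_comm_descent (gT : finGroupType) (G : {group gT}) m n x :
  x \in 'Z_(m + n)(G) -> comm_descent G 'Z_n(G) m x.
Proof.
by elim: m x => [|m IHm] x //= /ucnSP[_ Zx] g Gg; apply: IHm; exact: Zx.
Qed.

Lemma comm_descent_coset (gT : finGroupType) (G N : {group gT}) n x :
  N <| G -> x \in G -> comm_descent G N n x -> coset N x \in 'Z_n(G / N).
Proof.
case/andP=> _ nNG; elim: n x => [|n IHn] x Gx.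
  by move=> Nx; rewrite ucn0; apply/set1P; rewrite coset_id.
move=> Dx; apply/ucnSP; split=> [|_ /morphimP[g Ng Gg ->]].
  exact: mem_quotient.
by rewrite -morphR ?(subsetP nNG) // IHn ?groupR //; exact: Dx.
Qed.

(** If u ^+ p is in 'Z_j(G), then j commutations bring u into the elements
killed by p, hence into 'Z_(p - 2)(G), and p - 2 - j further ones into
'Z_j(G). *)
Lemma p_central_quo_ucn (p : nat) (gT : finGroupType) (G : {group gT}) j :
    p_central p G -> j <= p - 2 ->
    (forall x, x \in G -> x ^+ p \in 'Z_j(G) -> comm_descent G 'Ldiv_p(G) j x) ->
  p_central p (G / 'Z_j(G)).
Proof.
move=> pcG le_jp Dj _ /morphimP[u Nu Gu ->] up1.
have Zup : u ^+ p \in 'Z_j(G) by rewrite coset_idr ?groupX // morphX.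
apply: comm_descent_coset; rewrite ?ucn_normal //.
rewrite -(subnKC le_jp); apply: comm_descent_trans (Dj u Gu Zup) => a.
by case/LdivP=> Ga ap; apply: ucn_comm_descent; rewrite subnK ?pcG.
Qed.

(** The elements x and x ^ g have the same p-th power modulo 'Z_j(G) when
x ^+ p is in 'Z_j.+1(G), and G / 'Z_j(G) is p-central by the induction
hypothesis; hence the p-th power of [x, g] is in 'Z_j(G). *)
Lemma expg_ucn_comm_descent (p : nat) (gT : finGroupType) (G : {group gT}) j x :
    prime p -> p.-group G -> p_central p G -> j <= p - 2 ->
    x \in G -> x ^+ p \in 'Z_j(G) ->
  comm_descent G 'Ldiv_p(G) j x.
Proof.
move=> pr_p pG pcG; elim: j x => [|j IHj] x le_jp Gx Zxp.
  by apply/LdivP; split=> //; apply/set1P; rewrite ucn0 in Zxp.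
move=> g Gg; apply: (IHj); rewrite ?groupR // ?(ltnW le_jp) //.
have pcQ : p_central p (G / 'Z_j(G)).
  by apply: p_central_quo_ucn; rewrite ?(ltnW le_jp) // => y; apply: IHj; exact: ltnW.
have nZ := subsetP (ucn_norm j G).
rewrite coset_idr ?nZ ?groupX ?groupR // morphX ?nZ ?groupR //.
rewrite commgEl -[x ^ g]invgK morphM ?morphV ?nZ ?groupV ?groupJ //.
apply: (p_central_divgX pr_p (quotient_pgroup _ pG) pcQ);
  rewrite ?groupV ?mem_quotient ?groupJ //.
rewrite !expgVn -!morphX ?nZ ?groupJ //; congr _^-1.
have [_ Zcomm] := ucnSP _ _ _ Zxp.
rewrite -conjXg conjg_mulR morphM ?nZ ?groupR ?groupX //.
by rewrite [X in _ * X]coset_id ?mulg1 ?Zcomm.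
Qed.

(** * From exponent p to exponent p ^ i *)

Definition semi_p_abelian (p : nat) (gT : finGroupType) (G : {group gT}) : Prop :=
  {in G &, forall x y, x ^+ p = y ^+ p <-> (x * y^-1) ^+ p = 1}.

Lemma Ohm1_semi_p_abelian (p : nat) (gT : finGroupType) (G : {group gT}) :
  p.-group G -> semi_p_abelian p G -> 'Ohm_1(G) = 'Ldiv_p(G).
Proof.
move=> pG abG; rewrite (OhmE 1 pG) expn1; apply/eqP; rewrite eqEsubset subset_gen andbT.
by rewrite (gen_set_id (group_set_Ldiv _)) // => x y Gx Gy /abG; apply.
Qed.

(** The conditions at p ^ i.+1 in G are those at p ^ i in G / 'Ohm_1(G), which
is why the induction runs over a class C of groups stable under this
quotient. *)
Lemma strongly_semi_p_abelian_ind (p : nat)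
    (C : forall gT : finGroupType, {group gT} -> Prop) :
    (forall gT (G : {group gT}), p.-group G -> C gT G -> semi_p_abelian p G) ->
    (forall gT (G : {group gT}), p.-group G -> C gT G ->
       C (coset_of 'Ohm_1(G)) (G / 'Ohm_1(G))%G) ->
  forall gT (G : {group gT}), p.-group G -> C gT G -> strongly_semi_p_abelian p G.
Proof.
move=> Cab CQ gT G pG CG [//|i] _; elim: i gT G pG CG => [|i IHi] gT G pG CG x y Gx Gy.
  rewrite !expn1; exact: (Cab _ _ pG CG).
have abG := Cab _ _ pG CG.
have nO := subsetP (normal_norm (Ohm_normal 1 G)).
have memO u : u \in G -> u \in 'Ohm_1(G) <-> u ^+ p = 1.
  move=> Gu; rewrite (Ohm1_semi_p_abelian pG abG).
  by split=> [/LdivP[] | up] //; apply/LdivP.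
rewrite expnSr !expgM; set q := (p ^ i.+1)%N.
have cosq u : u \in G -> coset 'Ohm_1(G) u ^+ q = coset 'Ohm_1(G) (u ^+ q).
  by move=> Gu; rewrite morphX ?nO.
have eq_coset u v : u \in G -> v \in G ->
    coset 'Ohm_1(G) u = coset 'Ohm_1(G) v <-> u * v^-1 \in 'Ohm_1(G).
  move=> Gu Gv; have nu := nO _ Gu; have nv := nO _ Gv.
  split=> [eq_uv | Ouv].
    by rewrite coset_idr ?groupM ?groupV // morphM ?morphV ?groupV //= eq_uv mulgV.
  by rewrite -[u](mulgKV v) morphM ?groupM ?groupV //= coset_id ?mul1g.
have Gxq := groupX q Gx; have Gyq := groupX q Gy.
have Gd : x * y^-1 \in G by rewrite groupM ?groupV.
have Q := IHi _ _ (quotient_pgroup _ pG) (CQ _ _ pG CG) _ _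
  (mem_quotient 'Ohm_1(G) Gx) (mem_quotient 'Ohm_1(G) Gy).
rewrite -/q !cosq // -morphV ?nO // -morphM ?nO ?groupV // cosq // in Q.
apply: iff_trans (abG _ _ Gxq Gyq) _; apply: iff_trans (iff_sym (memO _ _)) _.
  by rewrite groupM ?groupV.
apply: iff_trans (iff_sym (eq_coset _ _ Gxq Gyq)) _; apply: iff_trans Q _.
apply: iff_trans (memO _ (groupX _ Gd)); split=> [dq1 | Od]; last exact: coset_id.
by rewrite coset_idr ?nO ?groupX.
Qed.

(** * The two requirements for odd primes *)

(** For the converse implication, z = x * y^-1 is killed by p, hence in
'Z_(p - 2)(G) together with [z, y], and the p-th power of z * y is that of
y. *)
Lemma p_central_semi_p_abelian (p : nat) (gT : finGroupType) (G : {group gT}) :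
  prime p -> p.-group G -> p_central p G -> semi_p_abelian p G.
Proof.
move=> pr_p pG pcG x y Gx Gy; split; first exact: p_central_divgX Gx Gy.
move=> zp1; set z := x * y^-1 in zp1.
have Gz : z \in G by rewrite groupM ?groupV.
have gL := group_set_Ldiv (p_central_divgX pr_p pG pcG).
have nLG : G \subset 'N(Group gL) := norm_Ldiv p (normG G).
have Lz : z \in Group gL by apply/LdivP.
have Lzy : [~ z, y] \in Group gL.
  by rewrite commgEl groupM ?groupV // memJ_norm ?(subsetP nLG).
rewrite -[x](mulgKV y) -/z (expMg_comm_torsion pr_p nLG) ?zp1 ?mul1g //.
  by move=> u /LdivP[].
by case/LdivP: Lzy; exact: pcG.
Qed.

Lemma p_central_quo_Ohm1 (p : nat) (gT : finGroupType) (G : {group gT}) :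
  prime p -> p.-group G -> p_central p G -> p_central p (G / 'Ohm_1(G)).
Proof.
move=> pr_p pG pcG _ /morphimP[u Nu Gu ->] up1.
have defO := Ohm1_semi_p_abelian pG (p_central_semi_p_abelian pr_p pG pcG).
have : u ^+ p \in 'Ohm_1(G) by rewrite coset_idr ?groupX // morphX.
rewrite {1}defO => /LdivP[Gup upp1].
apply: comm_descent_coset; rewrite ?Ohm_normal //= defO.
by apply: expg_ucn_comm_descent; rewrite ?pcG.
Qed.

(** * The prime 2 *)

Definition two_central (gT : finGroupType) (G : {group gT}) : Prop :=
  {in G, forall u, u ^+ 4 = 1 -> u \in 'Z(G)}.

(** If x and y have the same square, then x inverts u = x * y^-1; a power of u
of order 4 would be central and equal to its inverse. *)
Lemma two_central_semi_abelian (gT : finGroupType) (G : {group gT}) :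
  2.-group G -> two_central G -> semi_p_abelian 2 G.
Proof.
move=> pG cG x y Gx Gy; set u := x * y^-1.
have Gu : u \in G by rewrite groupM ?groupV.
split=> [eq_xy | u2].
  have uJ : u ^ x = u^-1.
    have xx : x * x = y * y by rewrite -!expg2.
    rewrite conjgE /u -mulgA mulKg invMg invgK.
    by apply: (mulgI y); apply: (mulIg x); rewrite mulKVg xx mulgA mulgKV.
  have [n ord_u] := p_natP (mem_p_elt pG Gu).
  case: n ord_u => [|[|n]] ord_u; try by apply/eqP; rewrite -order_dvdn ord_u.
  set w := u ^+ (2 ^ n); have Gw : w \in G by rewrite groupX.
  have /centerP[_ Cw] : w \in 'Z(G).
    by apply: cG; rewrite // -expgM -(expnD 2 n 2) addn2 -ord_u expg_order.
  have wV : w = w^-1.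
    by rewrite -[LHS](mulKg x) -(Cw _ Gx) -conjgE conjXg uJ expgVn.
  have : u ^+ (2 ^ n.+1) = 1.
    by rewrite expnSr expgM -/w expgS {2}wV mulgV.
  by move/eqP; rewrite -order_dvdn ord_u dvdn_Pexp2l // ltnn.
have cu : commute u y.
  have /centerP[_ Cu] : u \in 'Z(G) by apply: cG; rewrite // (expgM u 2 2) u2 expg1n.
  exact: Cu.
by rewrite -[x](mulgKV y) -/u expgMn // u2 mul1g.
Qed.

(** If u ^+ 8 = 1 then u ^+ 2 is central, so u and its conjugates have the same
square and differ by elements killed by 2. *)
Lemma two_central_quo_Ohm1 (gT : finGroupType) (G : {group gT}) :
  2.-group G -> two_central G -> two_central (G / 'Ohm_1(G)).
Proof.
move=> pG cG _ /morphimP[u Nu Gu ->] u4.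
have abG := two_central_semi_abelian pG cG.
have defO := Ohm1_semi_p_abelian pG abG.
have : u ^+ 4 \in 'Ohm_1(G) by rewrite coset_idr ?groupX // morphX.
rewrite {1}defO => /LdivP[_]; rewrite -expgM => u8.
have /centerP[_ Cu2] : u ^+ 2 \in 'Z(G) by apply: cG; rewrite ?groupX // -expgM.
apply/centerP; split=> [|_ /morphimP[g Ng Gg ->]]; first exact: mem_quotient.
apply/commgP; rewrite -morphR //= coset_id // defO; apply/LdivP.
rewrite groupR // commgEl -[u ^ g]invgK; split=> //.
apply/abG; rewrite ?groupV ?groupJ // !expgVn -conjXg; congr _^-1.
by rewrite conjgE Cu2 // mulKg.
Qed.

Theorem theorem2p2 (p : nat) (gT : finGroupType) (G : {group gT}) :
  prime p -> (p.-group G)%g -> generalised_p_central p G ->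
  strongly_semi_p_abelian p G.
Proof.
move=> pr_p pG; rewrite /generalised_p_central; case: eqVneq => [p2 | _] sOZ.
  rewrite p2 in pG *; apply: (strongly_semi_p_abelian_ind _ _ pG (C := two_central)).
  - exact: two_central_semi_abelian.
  - exact: two_central_quo_Ohm1.
  move=> u Gu u4; apply: (subsetP sOZ); rewrite (OhmE 2 pG) mem_gen //.
  exact/LdivP.
apply: (strongly_semi_p_abelian_ind _ _ pG (C := p_central p)).
- by move=> hT H pH; exact: p_central_semi_p_abelian.
- by move=> hT H pH; exact: p_central_quo_Ohm1.
move=> u Gu up; apply: (subsetP sOZ); rewrite (OhmE 1 pG) mem_gen // expn1.
exact/LdivP.
Qed.
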